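(* (Quasi-Mean Value Theorem) Let $X$ be a normed vector space over $\mathbb{R}$ with norm $\|\cdot\|$, let $\Omega\subseteq X$ be open and convex, and let $f:\Omega\to\mathbb{R}$ be continuous and specularly Gâteaux differentiable in $\Omega$ (i.e. at every point of $\Omega$). Suppose that for all $x\in\Omega$ and all $v\in X$ the one-sided directional derivatives $\partial_v^+f(x)$ and $\partial_v^-f(x)$ both exist as extended real numbers, and they are not both $\infty$ and not both $-\infty$. Then, for all $u,v\in\Omega$ with $u\neq v$, writing $w:=v-u\in X\setminus\{0\}$, $$\inf_{t\in(0,1)}\frac{\partial_w^{\wedge}\left(\|w\|f\right)(u+tw)}{\|w\|}\;\le\; f(v)-f(u)\;\le\;\sup_{t\in(0,1)}\frac{\partial_w^{\wedge}\left(\|w\|f\right)(u+tw)}{\|w\|}.$$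
   Context: The norm on $X\times\mathbb{R}$ is $\|(x,y)\|_{X\times\mathbb{R}}:=(\|x\|^2+|y|^2)^{1/2}$. $X^*$ is the space of continuous linear functionals on $X$. One-sided directional derivatives: $\partial_v^+f(x):=\lim_{h\searrow0}\frac{f(x+hv)-f(x)}{h}$ and $\partial_v^-f(x):=\lim_{h\searrow0}\frac{f(x)-f(x-hv)}{h}$, with values in $\overline{\mathbb{R}}=\mathbb{R}\cup\{-\infty,\infty\}$. Specular directional derivative of a function $g:\Omega\to\mathbb{R}$ at $x\in\Omega$ in direction $v\in X\setminus\{0\}$: $$\partial_v^{\wedge}g(x):=\lim_{h\searrow 0}\left[\frac{g(x+hv)-g(x)}{h}\cdot\frac{\|U\|_{X\times\mathbb{R}}}{\|U\|_{X\times\mathbb{R}}+\|V\|_{X\times\mathbb{R}}}+\frac{g(x)-g(x-hv)}{h}\cdot\frac{\|V\|_{X\times\mathbb{R}}}{\|U\|_{X\times\mathbb{R}}+\|V\|_{X\times\mathbb{R}}}\right]$$ (limit over $h>0$), when it exists in $\mathbb{R}$, where $U:=(hv,g(x)-g(x-hv))$ and $V:=(hv,g(x+hv)-g(x))$ for sufficiently small $h>0$; and $\partial_0^{\wedge}g(x):=0$. Note that $\partial_w^{\wedge}(\|w\|f)$ is the specular directional derivative of the scalar multiple $\|w\|f$ of $f$ by the constant $\|w\|$. $f$ is specularly Gâteaux differentiable at $x$ if $\partial_v^{\wedge}f(x)$ exists for all $v\in X$ and there is $\ell\in X^*$ with $\ell(v)=\partial_v^{\wedge}f(x)$ for all $v\in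 X$. *)

(* Defs.v *)
From mathcomp Require Import all_boot all_order all_algebra.
From mathcomp Require Import all_classical all_reals all_analysis.

Set Implicit Arguments.
Unset Strict Implicit.
Unset Printing Implicit Defensive.

Import Order.TTheory GRing.Theory Num.Theory.
Import numFieldNormedType.Exports.

Local Open Scope classical_set_scope.
Local Open Scope ring_scope.

(* A function Omega -> R on an open subset Omega of X is represented by a
   total function X -> R whose values outside Omega are irrelevant: every limit
   below is taken as h tends to 0 from the right, so at a point of Omega it only
   involves values of the function in Omega. *)

(* The library norm on X * R is the max norm, hence this explicit one. *)
Definition norm_prod2 (R : realType) (X : normedModType R) (x : X) (y : R) : R :=
  Num.sqrt (`|x| ^+ 2 + `|y| ^+ 2).

Definition fwd_quot (R : realType) (X : normedModType R) (g : X -> R)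
    (x v : X) (h : R) : R :=
  (g (x + h *: v) - g x) / h.

Definition bwd_quot (R : realType) (X : normedModType R) (g : X -> R)
    (x v : X) (h : R) : R :=
  (g x - g (x - h *: v)) / h.

(* The one-sided directional derivatives are limits in \bar R. *)
Definition has_derive_right (R : realType) (X : normedModType R) (g : X -> R)
    (x v : X) : Prop :=
  cvg ((fwd_quot g x v h)%:E @[h --> 0^'+]).

Definition derive_right (R : realType) (X : normedModType R) (g : X -> R)
    (x v : X) : \bar R :=
  lim ((fwd_quot g x v h)%:E @[h --> 0^'+]).

Definition has_derive_left (R : realType) (X : normedModType R) (g : X -> R)
    (x v : X) : Prop :=
  cvg ((bwd_quot g x v h)%:E @[h --> 0^'+]).

Definition derive_left (R : realType) (X : normedModType R) (g : X -> R)
    (x v : X) : \bar R :=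
  lim ((bwd_quot g x v h)%:E @[h --> 0^'+]).

Definition specular_quot (R : realType) (X : normedModType R) (g : X -> R)
    (x v : X) (h : R) : R :=
  let nU := norm_prod2 (h *: v) (g x - g (x - h *: v)) in
  let nV := norm_prod2 (h *: v) (g (x + h *: v) - g x) in
  fwd_quot g x v h * (nU / (nU + nV)) + bwd_quot g x v h * (nV / (nU + nV)).

Definition has_specular_derive (R : realType) (X : normedModType R) (g : X -> R)
    (x v : X) : Prop :=
  v = 0 \/ cvg (specular_quot g x v h @[h --> 0^'+]).

(* Meaningful only under [has_specular_derive g x v]: [lim] takes an arbitrary
   value when the limit does not exist. *)
Definition specular_derive (R : realType) (X : normedModType R) (g : X -> R)
    (x v : X) : R :=
  if v == 0 then 0 else lim (specular_quot g x v h @[h --> 0^'+]).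

Definition specular_gateaux (R : realType) (X : normedModType R) (g : X -> R)
    (x : X) : Prop :=
  (forall v : X, has_specular_derive g x v) /\
  exists l : {linear X -> R^o},
    continuous l /\ forall v : X, l v = specular_derive g x v.

(* Main.v *)
Require Import Defs.
From mathcomp Require Import all_boot all_order all_algebra.
From mathcomp Require Import all_classical all_reals all_analysis.
From mathcomp Require Import ring lra.

Set Implicit Arguments.
Unset Strict Implicit.
Unset Printing Implicit Defensive.

Import Order.TTheory GRing.Theory Num.Theory.
Import numFieldNormedType.Exports.

Local Open Scope classical_set_scope.
Local Open Scope ring_scope.

(** Restricting to the segment from [u] to [v], let [w = v - u] and [g = `|w| f].

    Two separate facts make the theorem true. The first is that the specular
    derivative of [g] exists along the segment. A specular quotient is [`|w|] times
    the tangent of the mean of the angles of the two one-sided quotients of [f]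
    ([specular_quot_angle]). These angles converge in [[-pi/2, pi/2]] whenever the
    one-sided derivatives exist in the extended reals, and their mean stays away
    from the vertical unless both derivatives are the same infinity
    ([has_specular_derive_sides]).

    The second is a mean value inequality. If [m < g v - g u], the function
    [t |-> g (u + t *: w) - m * t] has a larger value at 1 than at 0, so it first
    exceeds some intermediate level at an interior point [c]
    ([level_upcrossing]). There backward quotients of [g] with a small step are
    at least [m], and arbitrarily small steps make the forward quotient at least
    [m] as well. A specular quotient being a weighted mean of these two, its limit is at least [m]
    ([specular_derive_ge_slope]). Letting [m] tend to [g v - g u] and dividing by
    [`|w|] bounds the supremum; the same argument for [- g] bounds the infimum. *)

(** * Multiples and opposites of functions *)

Lemma fwd_quotZ (R : realType) (X : normedModType R) (f : X -> R) (x v : X)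
    (c h : R) : fwd_quot (fun y => c * f y) x v h = c * fwd_quot f x v h.
Proof. by rewrite /fwd_quot -mulrBr mulrA. Qed.

Lemma bwd_quotZ (R : realType) (X : normedModType R) (f : X -> R) (x v : X)
    (c h : R) : bwd_quot (fun y => c * f y) x v h = c * bwd_quot f x v h.
Proof. by rewrite /bwd_quot -mulrBr mulrA. Qed.

Lemma specular_quotN (R : realType) (X : normedModType R) (g : X -> R)
    (x v : X) (h : R) :
  specular_quot (fun y => - g y) x v h = - specular_quot g x v h.
Proof.
rewrite /specular_quot /fwd_quot /bwd_quot -!opprD /norm_prod2 !normrN.
by rewrite !mulNr opprD.
Qed.

Lemma has_specular_deriveN (R : realType) (X : normedModType R) (g : X -> R)
    (x v : X) :
  has_specular_derive g x v -> has_specular_derive (fun y => - g y) x v.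
Proof.
move=> [->|cvgg]; [by left|right].
by under eq_fun do rewrite specular_quotN; exact: is_cvgN.
Qed.

Lemma specular_deriveN (R : realType) (X : normedModType R) (g : X -> R)
    (x v : X) : has_specular_derive g x v ->
  specular_derive (fun y => - g y) x v = - specular_derive g x v.
Proof.
rewrite /specular_derive; case: eqVneq => [_ _|v0]; first by rewrite oppr0.
move=> [v00|cvgg]; first by rewrite v00 eqxx in v0.
by under eq_fun do rewrite specular_quotN; exact: limN.
Qed.

(** * Specular quotients as tangents of mean angles *)

Lemma sqrt_1Dsqr_gt0 (R : realType) (c : R) : 0 < Num.sqrt (1 + c ^+ 2).
Proof. by rewrite sqrtr_gt0 ltr_pwDl// sqr_ge0. Qed.

(** Writing [a = tan p] and [b = tan q], the left-hand side becomes
    [(sin p + sin q) / (cos p + cos q)], because [Num.sqrt (1 + a ^+ 2)] is the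
    inverse of [cos p]; the sum-to-product formulas turn this ratio into the
    tangent of the mean angle. This form, unlike the weighted mean, extends
    continuously to infinite slopes. *)
Lemma mean_angle_tan (R : realType) (a b : R) :
  let sa := Num.sqrt (1 + a ^+ 2) in
  let sb := Num.sqrt (1 + b ^+ 2) in
  a * (sb / (sb + sa)) + b * (sa / (sb + sa)) = tan ((atan a + atan b) / 2).
Proof.
have cosE c : cos (atan c) = (Num.sqrt (1 + c ^+ 2))^-1 by exact: cos_atan.
have sinE c : sin (atan c) = c * cos (atan c).
  rewrite -{2}(atanK c) /tan -mulrA mulVf ?mulr1//.
  by rewrite lt0r_neq0// cos_gt0_pihalf// atan_gtNpi2 atan_ltpi2.
move=> sa sb; have [sa0 sb0] : 0 < sa /\ 0 < sb by split; exact: sqrt_1Dsqr_gt0.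
set m := (atan a + atan b) / 2; set d := (atan a - atan b) / 2.
(* Sum-to-product: the common factor cos d cancels in the ratio. *)
have pE : atan a = m + d by rewrite /m /d; field.
have qE : atan b = m - d by rewrite /m /d; field.
have sumS : sin (atan a) + sin (atan b) = 2 * sin m * cos d.
  by rewrite pE qE sinD sinB; ring.
have sumC : cos (atan a) + cos (atan b) = 2 * cos m * cos d.
  by rewrite pE qE cosD cosB; ring.
have sumC_gt0 : 0 < cos (atan a) + cos (atan b).
  by rewrite !cosE addr_gt0 ?invr_gt0 ?sqrt_1Dsqr_gt0.
have /andP[cm0 cd0] : (cos m != 0) && (cos d != 0).
  by move: sumC_gt0; rewrite sumC => /lt0r_neq0; rewrite !mulf_eq0 !negb_or -andbA
    => /and3P[_ -> ->].
transitivity ((sin (atan a) + sin (atan b)) / (cos (atan a) + cos (atan b))).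
  rewrite !sinE !cosE -/sa -/sb; field.
  by rewrite !lt0r_neq0 ?addr_gt0.
by rewrite sumS sumC /tan; field; rewrite cm0 cd0.
Qed.

(** Dividing the quotients by [`|v|] makes them slopes with respect to arc length
    along the line directed by [v]; the weights in [specular_quot] are the
    secants of their angles, up to the common factor [h * `|v|]. *)
Lemma specular_quot_angle (R : realType) (X : normedModType R) (g : X -> R)
    (x v : X) (h : R) : v != 0 -> 0 < h ->
  specular_quot g x v h =
  `|v| * tan ((atan (fwd_quot g x v h / `|v|) +
               atan (bwd_quot g x v h / `|v|)) / 2).
Proof.
move=> v0 h0; have nv0 : 0 < `|v| by rewrite normr_gt0.
have c0 : 0 < h * `|v| by rewrite mulr_gt0.
have normE (y : R) : norm_prod2 (h *: v) y =
    h * `|v| * Num.sqrt (1 + (y / h / `|v|) ^+ 2).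
  rewrite /norm_prod2 normrZ gtr0_norm// real_normK ?num_real//.
  rewrite -[in RHS](gtr0_norm c0) -sqrtr_sqr -sqrtrM ?sqr_ge0//.
  by congr Num.sqrt; field; rewrite !lt0r_neq0.
rewrite -mean_angle_tan /specular_quot !normE -/(bwd_quot g x v h).
rewrite -/(fwd_quot g x v h).
set A := fwd_quot g x v h; set B := bwd_quot g x v h.
set sa := Num.sqrt (1 + (A / _) ^+ 2); set sb := Num.sqrt (1 + (B / _) ^+ 2).
have [sa0 sb0] : 0 < sa /\ 0 < sb by split; exact: sqrt_1Dsqr_gt0.
by field; rewrite !lt0r_neq0// addr_gt0// mulr_gt0.
Qed.

(** * Existence of the specular derivative *)

Definition atane (R : realType) (a : \bar R) : R :=
  match a with
  | a%:E => atan a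
  | +oo%E => pi / 2
  | -oo%E => - (pi / 2)
  end.

Lemma cvg_atane (R : realType) (T : Type) (F : set_system T) (A : T -> R)
    (a : \bar R) : Filter F ->
  (A t)%:E @[t --> F] --> a -> atan (A t) @[t --> F] --> atane a.
Proof.
move=> FF; case: a => [a| |] /=.
- move=> /fine_cvgP[_ Aa].
  by apply: continuous_cvg Aa; exact: continuous_atan.
- by move=> /cvgeryP Aa; apply: cvg_comp Aa _; exact: cvgy_atan.
- move=> /cvgerNyP /cvgNry Aa; rewrite -[X in X @ _ --> _]opprK; apply: cvgN.
  have -> : - (fun t => atan (A t)) = atan \o (- A).
    by apply/funext => t; rewrite /= !fctE atanN.
  exact: cvg_comp Aa (@cvgy_atan R).
Qed.

(** Two equal infinite slopes are the only case in which the mean angle is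
    vertical; opposite infinite slopes have mean angle zero. *)
Lemma atane_mean_bounds (R : realType) (a b : \bar R) :
  ~ (a = +oo%E /\ b = +oo%E) -> ~ (a = -oo%E /\ b = -oo%E) ->
  - (pi / 2) < (atane a + atane b) / 2 < pi / 2.
Proof.
have pi0 := pi_gt0 R.
have lo (c : R) := atan_gtNpi2 c; have hi (c : R) := atan_ltpi2 c.
case: a b => [a| |] [b| |] //= nP nN; try (by case: nP); try (by case: nN);
  try have := lo a; try have := hi a; try have := lo b; try have := hi b; lra.
Qed.

(** The angles of the one-sided quotients converge even where their slopes
    tend to infinity, and the tangent is continuous at their mean. *)
Lemma has_specular_derive_sides (R : realType) (X : normedModType R)
    (g : X -> R) (x v : X) (a b : \bar R) :
  (fwd_quot g x v h / `|v|)%:E @[h --> 0^'+] --> a ->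
  (bwd_quot g x v h / `|v|)%:E @[h --> 0^'+] --> b ->
  ~ (a = +oo%E /\ b = +oo%E) -> ~ (a = -oo%E /\ b = -oo%E) ->
  has_specular_derive g x v.
Proof.
move=> fa gb nP nN; have [->|v0] := eqVneq v 0; [by left|right].
apply: (cvgP (`|v| * tan ((atane a + atane b) / 2))).
have : `|v| * tan ((atan (fwd_quot g x v h / `|v|) +
      atan (bwd_quot g x v h / `|v|)) / 2) @[h --> 0^'+]
    --> `|v| * tan ((atane a + atane b) / 2).
  apply: cvgM; first exact: cvg_cst.
  apply: continuous_cvg.
    by apply/continuous_tan/lt0r_neq0/cos_gt0_pihalf; exact: atane_mean_bounds.
  by apply: cvgM; [apply: cvgD; exact: cvg_atane|exact: cvg_cst].
apply: cvg_trans; apply: near_eq_cvg; near=> h.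
by rewrite specular_quot_angle//; near: h; exact: nbhs_right_gt.
Unshelve. all: by end_near.
Qed.

(** * The mean value inequality *)

(** The point [c] is the infimum of the [t] with [k < G t]: the level [k] is not
    exceeded before [c], whereas it is exceeded arbitrarily close after [c]. Both
    one-sided slopes of [G] at [c] are thus nonnegative, the right one only along
    a sequence. The first crossing of [k] upward is needed for this: the last
    point where [G] is at most [k] would control only the right slope. *)
Lemma level_upcrossing (R : realType) (G : R -> R) (a b k : R) : a <= b ->
  (forall t, a <= t <= b -> {for t, continuous G}) -> G a < k < G b ->
  exists c, [/\ a < c < b, forall t, a <= t < c -> G t <= G c &
    forall e, 0 < e -> exists2 t, c < t < c + e & G c <= G t].
Proof.
move=> ab contG /andP[Gak Gbk].
pose E := [set t | a <= t <= b /\ k < G t].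
have Eb : E b by split; rewrite ?ab ?lexx.
have lbE : lbound E a by move=> t [/andP[]].
have infE : has_inf E by split; [exists b|exists a].
pose c := inf E.
have ac : a <= c by apply: lb_le_inf => //; exists b.
have cb : c <= b by apply: ge_inf => //; exists a.
have below t : a <= t < c -> G t <= k.
  move=> /andP[at_ tc]; rewrite leNgt; apply/negP => Gk.
  have /ge_inf : E t by split=> //; rewrite at_ (le_trans (ltW tc)).
  by move=> /(_ (ex_intro _ a lbE)); rewrite leNgt tc.
have above e : 0 < e -> exists2 t, c <= t < c + e & E t.
  move=> e0; have [t Et te] := inf_adherent e0 infE.
  by exists t => //; rewrite te andbT; apply: ge_inf => //; exists a.
have contc : {for c, continuous G} by apply: contG; rewrite ac.
have Gc : G c = k.
  apply/eqP; rewrite eq_le; apply/andP; split; rewrite leNgt; apply/negP => Gk.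
    have [e /= e0 eG] := cvgr_gt _ contc _ Gk.
    have {}ac : a < c.
      by rewrite lt_neqAle ac andbT; apply: contraTneq Gk => <-; rewrite -leNgt ltW.
    pose t := Num.max a (c - e / 2).
    have tc : t < c by rewrite gt_max ac ltrBlDr ltrDl divr_gt0.
    have := below t; rewrite tc le_max lexx => /(_ isT); rewrite leNgt eG//=.
    rewrite gtr0_norm ?subr_gt0// ltrBlDr -ltrBlDl lt_max; apply/orP; right.
    by rewrite ltrD2l ltrN2 ltr_pdivrMr// ltr_pMr// ltr1n.
  have [e /= e0 eG] := cvgr_lt _ contc _ Gk.
  have [t /andP[ct tce] [_]] := above _ e0; rewrite ltNge ltW//.
  by apply: eG; rewrite /= distrC ger0_norm ?subr_ge0// ltrBlDl.
exists c; split.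
- by rewrite !lt_neqAle ac cb !andbT; apply/andP; split; apply/eqP => cE;
    move: Gc; [rewrite -cE|rewrite cE] => Gc; move: Gak Gbk; rewrite Gc ltxx.
- by move=> t /below; rewrite Gc.
- move=> e /above[t /andP[ct tce] [_ kt]]; exists t; last by rewrite Gc ltW.
  rewrite tce andbT lt_neqAle ct andbT; apply/eqP => ctE.
  by move: kt; rewrite -ctE Gc ltxx.
Qed.

(** A specular quotient is a weighted mean of the two one-sided quotients. *)
Lemma specular_quot_ge (R : realType) (X : normedModType R) (g : X -> R)
    (x v : X) (h m : R) : v != 0 -> 0 < h ->
  m <= fwd_quot g x v h -> m <= bwd_quot g x v h -> m <= specular_quot g x v h.
Proof.
move=> v0 h0 mA mB; rewrite /specular_quot.
set nU := norm_prod2 _ _; set nV := norm_prod2 _ _.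
have norm_gt0 y : 0 < norm_prod2 (h *: v) y.
  rewrite sqrtr_gt0 ltr_pwDl ?sqr_ge0// exprn_gt0// normr_gt0.
  by rewrite scaler_eq0 negb_or v0 gt_eqF.
have [nU0 nV0] : 0 < nU /\ 0 < nV by split; exact: norm_gt0.
have -> : m = m * (nU / (nU + nV)) + m * (nV / (nU + nV)).
  by field; rewrite lt0r_neq0// addr_gt0.
by rewrite lerD// ler_wpM2r// divr_ge0// ltW// addr_gt0.
Qed.

(** At an upcrossing point of [t |-> g (u + t *: w) - m * t], the specular
    quotients are at least [m] for arbitrarily small [h]. Since they
    converge, so is their limit. *)
Lemma specular_derive_ge_slope (R : realType) (X : normedModType R) (g : X -> R)
    (u w : X) (m : R) : w != 0 ->
  (forall t : R, 0 <= t <= 1 -> {for u + t *: w, continuous g}) ->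
  (forall t : R, 0 < t < 1 -> has_specular_derive g (u + t *: w) w) ->
  m < g (u + w) - g u ->
  exists2 t : R, 0 < t < 1 & m <= specular_derive g (u + t *: w) w.
Proof.
move=> w0 contg sg mg.
pose G (t : R) := g (u + t *: w) - m * t.
have contG t : 0 <= t <= 1 -> {for t, continuous G}.
  move=> t01; apply: cvgB; last by apply: cvgM; [exact: cvg_cst|exact: cvg_id].
  apply: (@continuous_comp _ _ _ (fun s : R => u + s *: w) g); last exact: contg.
  by apply: cvgD; [exact: cvg_cst|apply: cvgZl; exact: cvg_id].
(* Any level strictly between the end values would do. *)
have [k kG] : exists k, G 0 < k < G 1.
  exists ((G 0 + G 1) / 2); have : G 0 < G 1.
    by rewrite /G scale0r scale1r addr0; lra.
  by lra.
have [c [c01 left_c right_c]] := level_upcrossing ler01 contG kG.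
exists c => //; rewrite /specular_derive (negbTE w0).
have [w00|cvgq] := sg _ c01; first by rewrite w00 eqxx in w0.
rewrite leNgt; apply/negP => /(cvgr_lt _ cvgq)[e /= e0 eq].
(* The step t - c must lie in the neighbourhood where the quotient is below m,
   and also keep c - (t - c), used by the backward quotient, above 0. *)
have /right_c[t /andP[ct tce] Gct] : 0 < Num.min e c.
  by rewrite lt_min e0; case/andP: c01.
have h0 : 0 < t - c by rewrite subr_gt0.
have : t - c < Num.min e c by rewrite ltrBlDl.
rewrite lt_min => /andP[he hc].
have /eq : ball_ Num.norm 0 e (t - c) by rewrite /ball_ /= sub0r normrN gtr0_norm.
move=> /(_ h0); rewrite ltNge specular_quot_ge// ler_pdivlMr//.
  move: Gct; rewrite /G -addrA -scalerDl.
  have -> : c + (t - c) = t by ring.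
  lra.
have := left_c (c - (t - c)); rewrite /G => /(_ _).
have -> : u + c *: w - (t - c) *: w = u + (c - (t - c)) *: w.
  by rewrite -addrA -scalerBl.
by move=> /(_ ltac:(lra)); lra.
Qed.

Theorem theorem4p5 (R : realType) (X : normedModType R) (Omega : set X)
    (f : X -> R)
    (Omega_open : open Omega)
    (Omega_convex : convex_set Omega)
    (f_cont : {within Omega, continuous f})
    (f_spec : forall x : X, Omega x -> specular_gateaux f x)
    (f_sides : forall x v : X, Omega x ->
      [/\ has_derive_right f x v,
          has_derive_left f x v,
          ~ (derive_right f x v = +oo%E /\ derive_left f x v = +oo%E) &
          ~ (derive_right f x v = -oo%E /\ derive_left f x v = -oo%E)])
    (u v : X) (Omega_u : Omega u) (Omega_v : Omega v) (neq_uv : u <> v) :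
  let w := v - u in
  let g := fun x : X => `|w| * f x in
  let S := [set (specular_derive g (u + t *: w) w / `|w|)%:E
             | t in [set t : R | 0 < t < 1]] in
  (forall t : R, 0 < t < 1 -> has_specular_derive g (u + t *: w) w) /\
  (ereal_inf S <= (f v - f u)%:E <= ereal_sup S)%E.
Proof.
move=> w g S.
have w0 : w != 0 by rewrite subr_eq0; apply/eqP => vu; apply: neq_uv.
have nw0 : 0 < `|w| by rewrite normr_gt0.
have uwE : u + w = v by rewrite /w addrC subrK.
have seg (t : R) : 0 <= t <= 1 -> Omega (u + t *: w).
  move=> /andP[t0 t1]; apply/set_mem.
  have -> : u + t *: w = conv (Itv01 t0 t1) (v : convex_lmodType X) u.
    rewrite /conv /= /w /unstable.onem scalerBr scalerBl scale1r.
    by rewrite addrCA [u - _]addrC addrA.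
  by apply: Omega_convex; exact/mem_set.
have contg (t : R) : 0 <= t <= 1 -> {for u + t *: w, continuous g}.
  move=> /seg Ot; apply: cvgM; first exact: cvg_cst.
  by move: f_cont; rewrite continuous_open_subspace//; apply; exact/mem_set.
have specg (t : R) : 0 < t < 1 -> has_specular_derive g (u + t *: w) w.
  move=> /andP[t0 t1]; have /seg /f_sides := (introT andP (conj (ltW t0) (ltW t1))).
  move=> /(_ w)[cvgr cvgl nP nN].
  apply: has_specular_derive_sides nP nN.
    have -> // : (fun h => (fwd_quot g (u + t *: w) w h / `|w|)%:E) =
                 (fun h => (fwd_quot f (u + t *: w) w h)%:E).
    by apply/funext => h; rewrite fwd_quotZ mulrAC divff ?mul1r ?gt_eqF.
  have -> // : (fun h => (bwd_quot g (u + t *: w) w h / `|w|)%:E) =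
               (fun h => (bwd_quot f (u + t *: w) w h)%:E).
  by apply/funext => h; rewrite bwd_quotZ mulrAC divff ?mul1r ?gt_eqF.
split=> //; apply/andP; split.
- apply/lee_addgt0Pr => e e0.
  have [t t01] : exists2 t : R, 0 < t < 1 &
      `|w| * (f u - f v - e) <= specular_derive (fun x => - g x) (u + t *: w) w.
    apply: specular_derive_ge_slope => //.
    + by move=> t /contg ct; exact: cvgN.
    + by move=> t /specg /has_specular_deriveN.
    + by rewrite uwE /g opprK [ltRHS]addrC -mulrBr ltr_pM2l//; lra.
  rewrite specular_deriveN; last exact: specg.
  move=> le_t; apply: (@le_trans _ _ (specular_derive g (u + t *: w) w / `|w|)%:E).
    by apply: ereal_inf_lbound; exists t.
  by rewrite -EFinD lee_fin ler_pdivrMr// mulrC; lra.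
- apply/lee_subgt0Pr => e e0.
  have [t t01 le_t] : exists2 t : R, 0 < t < 1 &
      `|w| * (f v - f u - e) <= specular_derive g (u + t *: w) w.
    apply: specular_derive_ge_slope => //.
    by rewrite uwE /g -mulrBr ltr_pM2l//; lra.
  apply: (@le_trans _ _ (specular_derive g (u + t *: w) w / `|w|)%:E).
    by rewrite -EFinB lee_fin ler_pdivlMr// mulrC.
  by apply: ereal_sup_ubound; exists t.
Qed.
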